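(* Let $E$ be a Banach lattice equipped with a truncation $\tau$ that is bounded and not unital. Then $E$ contains a closed Riesz subspace that is lattice isomorphic to $c_0$. In particular, $E$ is neither reflexive nor weakly sequentially complete, and $E$ is not an $AL$-space.
   Context: All Riesz spaces are real. A truncation on a Riesz space $E$ is a map $\tau : E^{+} \to E^{+}$ such that $\tau(f) \wedge g = f \wedge \tau(g)$ for all $f, g \in E^{+}$. It is unital if there is $u \in E^{+}$ with $\tau(f) = u \wedge f$ for all $f \in E^{+}$. If $E$ carries a lattice norm $\|\cdot\|_E$, then $\tau$ is bounded if $\sup\{\|\tau(f)\|_E : f \in E^{+}\} < \infty$. An $AL$-space is a Banach lattice whose norm satisfies $\|x+y\| = \|x\| + \|y\|$ whenever $x \wedge y = 0$ (for Banach lattices this is equivalent to additivity of the norm on the whole positive cone). A lattice isomorphism is a linear bijection preserving the lattice operations. *)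

(* Defs.v *)
From HB Require Import structures.
From mathcomp Require Import all_boot all_order all_algebra.
From mathcomp Require Import all_classical all_reals all_analysis.

Set Implicit Arguments.
Unset Strict Implicit.
Unset Printing Implicit Defensive.

Import Order.TTheory GRing.Theory Num.Theory.
Import numFieldNormedType.Exports.

Local Open Scope classical_set_scope.
Local Open Scope ring_scope.

(* The order is part of the mixin: as [Num.NumDomain] and [Num.RealDomain] already
   join norms, additive groups and orders, Hierarchy Builder rejects any new
   structure that joins [Order.POrder] with [NormedModule] or [Order.Lattice]
   with [GRing.Zmodule]. The lattice theory of the library is available on the
   alias [riesz_lattice] below. The notation [`|x|] is the norm of [x]; its
   modulus is [modulus x]. *)

HB.mixin Record Lmodule_isRiesz (R : numDomainType) E & GRing.Lmodule R E := {
  riesz_le : rel E;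
  riesz_meet : E -> E -> E;
  riesz_join : E -> E -> E;
  riesz_lexx : reflexive riesz_le;
  riesz_le_anti : antisymmetric riesz_le;
  riesz_le_trans : transitive riesz_le;
  riesz_lexI : forall z x y : E,
    riesz_le z (riesz_meet x y) = riesz_le z x && riesz_le z y;
  riesz_leUx : forall x y z : E,
    riesz_le (riesz_join x y) z = riesz_le x z && riesz_le y z;
  riesz_leD2r : forall z x y : E, riesz_le x y -> riesz_le (x + z) (y + z);
  riesz_scale_ge0 : forall (a : R) (x : E),
    0 <= a -> riesz_le 0 x -> riesz_le 0 (a *: x)
}.

#[short(type="rieszSpaceType")]
HB.structure Definition RieszSpace (R : numDomainType) :=
  {E of GRing.Lmodule R E & Lmodule_isRiesz R E}.

Notation "x \le y" := (riesz_le x y)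
  (at level 70, y at next level) : ring_scope.
Notation "x \wedge y" := (riesz_meet x y)
  (at level 48, left associativity) : ring_scope.
Notation "x \vee y" := (riesz_join x y)
  (at level 52, left associativity) : ring_scope.

Definition riesz_lattice (R : numDomainType) (E : rieszSpaceType R) : Type := E.

Fact riesz_display : Order.disp_t. Proof. exact: (Order.Disp tt tt). Qed.

Section RieszLattice.
Context (R : numDomainType) (E : rieszSpaceType R).

HB.instance Definition _ := Choice.on (riesz_lattice E).
HB.instance Definition _ := Order.Le_isPOrder.Build riesz_display
  (riesz_lattice E) (@riesz_lexx R E) (@riesz_le_anti R E)
  (@riesz_le_trans R E).
HB.instance Definition _ := Order.POrder_MeetJoin_isLattice.Build riesz_display
  (riesz_lattice E) (@riesz_lexI R E) (@riesz_leUx R E).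

End RieszLattice.

Definition modulus (R : numDomainType) (E : rieszSpaceType R) (x : E) : E :=
  x \vee (- x).

HB.mixin Record RieszSpace_hasLatticeNorm (R : numFieldType) E
    & RieszSpace R E & NormedModule R E := {
  ler_norm_modulus : forall x y : E, modulus x \le modulus y -> `|x| <= `|y|
}.

#[short(type="banachLatticeType")]
HB.structure Definition BanachLattice (R : numFieldType) :=
  {E of RieszSpace R E & CompleteNormedModule R E
   & RieszSpace_hasLatticeNorm R E}.

Definition pos_cone (R : numDomainType) (E : rieszSpaceType R) : set E :=
  [set x | 0 \le x].
Arguments pos_cone {R} E _.

Definition riesz_subspace (R : numDomainType) (E : rieszSpaceType R)
    (F : set E) : Prop :=
  [/\ F 0,
      (forall (a : R) x y, F x -> F y -> F (a *: x + y)),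
      (forall x y, F x -> F y -> F (x \wedge y)) &
      (forall x y, F x -> F y -> F (x \vee y))].

Definition lattice_isomorphism (R : numDomainType) (X Y : rieszSpaceType R)
    (F : set Y) (phi : {linear X -> Y}) : Prop :=
  [/\ set_bij [set: X] F phi,
      {morph phi : x y / (x \wedge y)} &
      {morph phi : x y / (x \vee y)}].

Definition lattice_isomorphic (R : numDomainType) (X Y : rieszSpaceType R)
    (F : set Y) : Prop :=
  exists phi : {linear X -> Y}, lattice_isomorphism F phi.

Section C0.
Context (R : realType).

Definition null_sequence : {pred nat -> R} :=
  mem [set u : nat -> R | u n @[n --> \oo] --> (0 : R)].

Record c0 := C0 {
  c0_fun :> nat -> R ;
  c0_funP : c0_fun \in null_sequence
}.

HB.instance Definition _ := [isSub for c0_fun].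
HB.instance Definition _ := [Choice of c0 by <:].

Let null_sequence_le (u v : nat -> R) :
  u \in null_sequence -> (forall n, `|v n| <= `|u n|) -> v \in null_sequence.
Proof.
move=> /set_mem/cvgr0Pnorm_lt u0 vu; apply/mem_set/cvgr0Pnorm_lt => e e0.
by apply: filterS (u0 e e0) => n; exact: le_lt_trans (vu n).
Qed.

Let null_sequence_norm (u : nat -> R) :
  u \in null_sequence -> (fun n => `|u n|) \in null_sequence.
Proof. by move=> u0; apply: null_sequence_le u0 _ => n; rewrite normr_id. Qed.

Let null_sequenceD (u v : nat -> R) :
  u \in null_sequence -> v \in null_sequence -> u + v \in null_sequence.
Proof.
by move=> /set_mem u0 /set_mem v0; apply/mem_set; rewrite /= -(addr0 0); exact: cvgD.
Qed.

Let null_sequence_submod : submod_closed null_sequence.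
Proof.
split; first by apply/mem_set; exact: cvg_cst.
move=> a u v u0 v0; apply: null_sequenceD => //; apply/mem_set.
rewrite /= -(mulr0 a); apply: cvgM; first exact: cvg_cst.
exact: set_mem u0.
Qed.

Let c0_meet_subproof (u v : c0) :
  (fun n => Num.min (u n) (v n)) \in null_sequence.
Proof.
apply: null_sequence_le (null_sequenceD (null_sequence_norm (c0_funP u))
  (null_sequence_norm (c0_funP v))) _ => n.
rewrite [leRHS]ger0_norm ?addr_ge0//.
by rewrite minEle; case: ifP => _; rewrite ?lerDl ?lerDr.
Qed.

Let c0_join_subproof (u v : c0) :
  (fun n => Num.max (u n) (v n)) \in null_sequence.
Proof.
apply: null_sequence_le (null_sequenceD (null_sequence_norm (c0_funP u))
  (null_sequence_norm (c0_funP v))) _ => n.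
rewrite [leRHS]ger0_norm ?addr_ge0//.
by rewrite maxEle; case: ifP => _; rewrite ?lerDl ?lerDr.
Qed.

Definition c0_meet (u v : c0) : c0 := C0 (c0_meet_subproof u v).

Definition c0_join (u v : c0) : c0 := C0 (c0_join_subproof u v).

HB.instance Definition _ := GRing.isSubmodClosed.Build _ _
  null_sequence null_sequence_submod.
HB.instance Definition _ := [SubChoice_isSubLmodule of c0 by <:].

Definition c0_le (u v : c0) : bool := `[< forall n, u n <= v n >].

Let c0_lexx : reflexive c0_le.
Proof. by move=> u; apply/asboolP. Qed.

Let c0_le_anti : antisymmetric c0_le.
Proof.
move=> u v /andP[/asboolP uv /asboolP vu]; apply/val_inj/funext => n.
by apply/eqP; rewrite eq_le uv vu.
Qed.

Let c0_le_trans : transitive c0_le.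
Proof.
move=> v u w /asboolP uv /asboolP vw; apply/asboolP => n.
exact: le_trans (uv n) (vw n).
Qed.

Let c0_lexI (w u v : c0) : c0_le w (c0_meet u v) = c0_le w u && c0_le w v.
Proof.
apply/asboolP/andP => [wuv|[/asboolP wu /asboolP wv] n].
  by split; apply/asboolP => n; move: (wuv n); rewrite le_min => /andP[].
by rewrite le_min wu wv.
Qed.

Let c0_leUx (u v w : c0) : c0_le (c0_join u v) w = c0_le u w && c0_le v w.
Proof.
apply/asboolP/andP => [uvw|[/asboolP uw /asboolP vw] n].
  by split; apply/asboolP => n; move: (uvw n); rewrite ge_max => /andP[].
by rewrite ge_max uw vw.
Qed.

Let c0_leD2r (w u v : c0) : c0_le u v -> c0_le (u + w) (v + w).
Proof. by move=> /asboolP uv; apply/asboolP => n; exact: lerD (uv n) (lexx _). Qed.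

Let c0_scale_ge0 (a : R) (u : c0) : 0 <= a -> c0_le 0 u -> c0_le 0 (a *: u).
Proof. by move=> a0 /asboolP u0; apply/asboolP => n; exact: mulr_ge0 (u0 n). Qed.

HB.instance Definition _ := Lmodule_isRiesz.Build R c0 c0_lexx c0_le_anti
  c0_le_trans c0_lexI c0_leUx c0_leD2r c0_scale_ge0.

End C0.

(* A map from the positive cone to itself is given by a function on [E] of which
   only the restriction to the positive cone is used. *)
Definition truncation (R : numDomainType) (E : rieszSpaceType R)
    (tau : E -> E) : Prop :=
  set_fun (pos_cone E) (pos_cone E) tau /\
  forall f g, 0 \le f -> 0 \le g -> tau f \wedge g = f \wedge tau g.

Definition unital_truncation (R : numDomainType) (E : rieszSpaceType R)
    (tau : E -> E) : Prop :=
  exists2 u, 0 \le u & forall f, 0 \le f -> tau f = u \wedge f.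

Definition bounded_truncation (R : realType) (E : banachLatticeType R)
    (tau : E -> E) : Prop :=
  (ereal_sup [set (`|tau f|)%:E | f in pos_cone E] < +oo)%E.

Definition AL_space (R : realType) (E : banachLatticeType R) : Prop :=
  forall x y : E, x \wedge y = 0 -> `|x + y| = `|x| + `|y|.

Section Dual.
Context (R : realType) (E : normedModType R).

Definition continuous_functional : {pred E -> R^o} :=
  mem [set f : E -> R^o | linear f /\ continuous f].

Record dual := Dual {
  dual_fun :> E -> R^o ;
  dual_funP : dual_fun \in continuous_functional
}.

HB.instance Definition _ := [isSub for dual_fun].
HB.instance Definition _ := gen_eqMixin dual.
HB.instance Definition _ := gen_choiceMixin dual.

Let continuous_functional_submod : submod_closed continuous_functional.
Proof.
split.
  apply/mem_set; split; last by move=> x; exact: cvg_cst.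
  by move=> a x y; rewrite /= scaler0 addr0.
move=> a f g /set_mem[lf cf] /set_mem[lg cg]; apply/mem_set; split.
  move=> b x y.
  change (a *: f (b *: x + y) + g (b *: x + y) =
          b *: (a *: f x + g x) + (a *: f y + g y)).
  rewrite lf lg !scalerDr !scalerA (mulrC a b) -!addrA; congr (_ + _).
  by rewrite addrCA.
move=> x; apply: cvgD; last exact: cg.
by apply: cvgZr; exact: cf.
Qed.

HB.instance Definition _ := GRing.isSubmodClosed.Build _ _
  continuous_functional continuous_functional_submod.
HB.instance Definition _ := [SubChoice_isSubLmodule of dual by <:].

Lemma dual_linear (f : dual) : linear f.
Proof. by have /set_mem[] := dual_funP f. Qed.

Lemma dual_continuous (f : dual) : continuous f.
Proof. by have /set_mem[] := dual_funP f. Qed.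

HB.instance Definition _ (f : dual) :=
  GRing.isLinear.Build R E R^o *:%R (dual_fun f) (dual_linear f).

Definition dual_norm (f : dual) : R :=
  sup [set `|f x| | x in [set x : E | `|x| <= 1]].

Lemma dual_norm_has_sup (f : dual) :
  has_sup [set `|f x| | x in [set x : E | `|x| <= 1]].
Proof.
split; first by exists `|f 0|, 0 => //=; rewrite normr0.
have /linear_bounded_continuous/linear_boundedP := @dual_continuous f.
move=> /pinfty_ex_gt0[M M0 fM]; exists M => _ [x /= x1 <-].
by rewrite (le_trans (fM x))// ler_piMr// ltW.
Qed.

Lemma ler_dual_norm (f : dual) (x : E) : `|f x| <= dual_norm f * `|x|.
Proof.
have [->|x0] := eqVneq x 0; first by rewrite linear0 !normr0 mulr0.
rewrite -ler_pdivrMr ?normr_gt0//.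
apply: ub_le_sup; first by have [] := dual_norm_has_sup f.
exists (`|x|^-1 *: x); rewrite /= ?linearZ /= normrZ ger0_norm ?invr_ge0//.
  by rewrite mulVf ?normr_eq0.
by rewrite mulrC.
Qed.

Lemma dual_norm_le (f : dual) (M : R) :
  (forall x, `|x| <= 1 -> `|f x| <= M) -> dual_norm f <= M.
Proof.
move=> fM; apply: ge_sup; first by have [] := dual_norm_has_sup f.
by move=> _ [x /= x1 <-]; exact: fM.
Qed.

Let dual_norm_ge0 (f : dual) : 0 <= dual_norm f.
Proof.
apply: (le_trans (normr_ge0 (f 0))).
apply: ub_le_sup; first by have [] := dual_norm_has_sup f.
by exists 0 => //=; rewrite normr0.
Qed.

Let ler1_dual_norm (f : dual) x : `|x| <= 1 -> `|f x| <= dual_norm f.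
Proof. by move=> x1; rewrite (le_trans (ler_dual_norm f x))// ler_piMr. Qed.

Let dual_normD (f g : dual) : dual_norm (f + g) <= dual_norm f + dual_norm g.
Proof.
apply: dual_norm_le => x x1.
by rewrite (le_trans (ler_normD (f x) (g x)))// lerD// ler1_dual_norm.
Qed.

Let dual_normZ_le (a : R) (f : dual) : dual_norm (a *: f) <= `|a| * dual_norm f.
Proof.
apply: dual_norm_le => x x1.
rewrite [X in `|X|](_ : _ = a * f x)// normrM.
by rewrite ler_wpM2l// ler1_dual_norm.
Qed.

Let dual_normZ (a : R) (f : dual) : dual_norm (a *: f) = `|a| * dual_norm f.
Proof.
apply/eqP; rewrite eq_le dual_normZ_le/=.
have [->|a0] := eqVneq a 0; first by rewrite normr0 mul0r.
rewrite -ler_pdivlMl ?normr_gt0// -normfV.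
by have := dual_normZ_le a^-1 (a *: f); rewrite scalerA mulVf// scale1r.
Qed.

Let dual_norm0_eq0 (f : dual) : dual_norm f = 0 -> f = 0.
Proof.
move=> f0; apply/val_inj/funext => x; apply/eqP.
by rewrite -normr_le0 (le_trans (ler_dual_norm f x))// f0 mul0r.
Qed.

HB.instance Definition _ :=
  Lmodule_isNormed.Build R dual dual_normD dual_normZ dual_norm0_eq0.

End Dual.

Arguments continuous_functional {R} E _.

Section Bidual.
Context (R : realType) (E : normedModType R).

Let eval_functional (x : E) :
  (fun f : dual E => f x : R^o) \in continuous_functional (dual E).
Proof.
have lin : linear (fun f : dual E => f x : R^o) by [].
pose ev := HB.pack_for {linear dual E -> R^o} (fun f : dual E => f x : R^o)
  (GRing.isLinear.Build R (dual E) R^o *:%R _ lin).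
apply/mem_set; split => //.
apply: (@bounded_linear_continuous _ _ _ ev); apply/linear_boundedP.
near=> r => f; rewrite (le_trans (ler_dual_norm f x))// mulrC ler_wpM2r//.
exact: (normr_ge0 (f : dual E)).
Unshelve. all: by end_near. Qed.

Definition bidual_embedding (x : E) : dual (dual E) := Dual (eval_functional x).

Definition reflexive_space : Prop :=
  set_surj [set: E] [set: dual (dual E)] bidual_embedding.

Definition weakly_cauchy (u : nat -> E) : Prop :=
  forall f : dual E, cauchy (f (u n) @[n --> \oo]).

Definition weakly_converges (u : nat -> E) (x : E) : Prop :=
  forall f : dual E, f (u n) @[n --> \oo] --> f x.

Definition weakly_sequentially_complete : Prop :=
  forall u : nat -> E, weakly_cauchy u -> exists x, weakly_converges u x.

End Bidual.

(* Main.v *)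
Require Import Defs.
From HB Require Import structures.
From mathcomp Require Import all_boot all_order all_algebra.
From mathcomp Require Import all_classical all_reals all_analysis.

Set Implicit Arguments.
Unset Strict Implicit.
Unset Printing Implicit Defensive.

Import Order.TTheory GRing.Theory Num.Theory.
Import numFieldNormedType.Exports.

Local Open Scope classical_set_scope.
Local Open Scope ring_scope.

(** Write [1] for the missing unit, so that [tau f] is thought of as
    [f \wedge 1]; for [f \le g] one does have [tau f = f \wedge tau g]. If the
    increasing net of all [tau f] were norm Cauchy, its limit would be a unit.
    As [tau] is not unital, every [f] in the cone therefore has a [g] above it
    with [`|tau g - tau f|] at least a fixed [e > 0].

    The key point is that such increments can be cut down to disjoint pieces
    that keep a fixed part of the norm. The increment [tau g - tau f] lives where [f < 1], since
    [(f - tau f) \wedge (tau g - tau f) = 0]. Cutting off the part of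
    [tau b - tau a] below [k^-1 * 1] leaves something that lives where
    [b > k^-1], that is, where [k b > 1]; all increments taken after [k b] vanish
    there. The cut costs at most [M / k] in norm, where [M] bounds [tau], so for
    large [k] the pieces [v n] stay bounded away from 0. Their partial sums
    stay below a value of [tau], hence are bounded by [M]
    ([trunc_disjoint_sequence]).

    Given such a sequence, [a |-> \sum_n a n *: v n] embeds [c0]: the sum
    converges with norm at most [sup |a|] times [M], coordinates are recovered
    since the modulus of the sum dominates [|a n| *: v n], and disjointness makes
    the map a lattice morphism ([c0_sublattice]).

    The partial sums of [v] then refute the other three properties. In an
    AL-space their norms would grow linearly. They are weakly Cauchy, because a
    functional is absolutely summable along [v], but have no weak limit
    ([partial_sums_no_weak_limit]): by Hahn-Banach a limit would lie in the copy
    of [c0] and have all its coordinates equal to 1. In a reflexive space a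
    bounded weakly Cauchy sequence converges weakly, its pointwise limit on the
    dual being represented by a vector, so reflexivity fails too. *)

(** * Arithmetic of Riesz spaces *)

Section RieszArithmetic.
Context (R : numDomainType) (E : rieszSpaceType R).
Implicit Types x y z t : E.

Lemma rleIl x y : x \wedge y \le x.
Proof. by have := riesz_lexx (x \wedge y); rewrite riesz_lexI => /andP[]. Qed.

Lemma rleIr x y : x \wedge y \le y.
Proof. by have := riesz_lexx (x \wedge y); rewrite riesz_lexI => /andP[]. Qed.

Lemma rleUl x y : x \le x \vee y.
Proof. by have := riesz_lexx (x \vee y); rewrite riesz_leUx => /andP[]. Qed.

Lemma rleUr x y : y \le x \vee y.
Proof. by have := riesz_lexx (x \vee y); rewrite riesz_leUx => /andP[]. Qed.

Lemma rmeetC x y : x \wedge y = y \wedge x.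
Proof. exact: (@meetC _ (riesz_lattice E)). Qed.

Lemma rmeetxx x : x \wedge x = x.
Proof. exact: (@meetxx _ (riesz_lattice E)). Qed.

Lemma rmeet_idPl x y : reflect (x \wedge y = x) (x \le y).
Proof. exact: (@meet_idPl _ (riesz_lattice E)). Qed.

Lemma rle_anti x y : x \le y -> y \le x -> x = y.
Proof. by move=> xy yx; apply: riesz_le_anti; rewrite xy. Qed.

Lemma rle_trans y x z : x \le y -> y \le z -> x \le z.
Proof. exact: riesz_le_trans. Qed.

Lemma rleD2r z x y : (x + z \le y + z) = (x \le y).
Proof.
apply/idP/idP => [/(riesz_leD2r (- z))|]; first by rewrite !addrK.
exact: riesz_leD2r.
Qed.

Lemma rleD x y z t : x \le y -> z \le t -> x + z \le y + t.
Proof.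
move=> xy zt; apply: (@rle_trans (y + z)); first by rewrite rleD2r.
by rewrite ![y + _]addrC rleD2r.
Qed.

Lemma rsubr_ge0 x y : (0 \le y - x) = (x \le y).
Proof. by rewrite -(rleD2r x) add0r subrK. Qed.

Lemma rleBlDr x y z : (x - y \le z) = (x \le z + y).
Proof. by rewrite -(rleD2r y) subrK. Qed.

Lemma rleN2 x y : (- x \le - y) = (y \le x).
Proof. by rewrite -(rleD2r (x + y)) addKr [x + y]addrC addKr. Qed.

Lemma raddr_ge0 x y : 0 \le x -> 0 \le y -> 0 \le x + y.
Proof. by move=> x0 y0; rewrite -[0]addr0; exact: rleD. Qed.

Lemma rler_wpDr x y : 0 \le y -> x \le x + y.
Proof. by move=> y0; rewrite -{1}[x]addr0; exact: rleD (riesz_lexx _) y0. Qed.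

Lemma rler_wpDl x y : 0 \le x -> y \le x + y.
Proof. by rewrite addrC; exact: rler_wpDr. Qed.

Lemma rsumr_ge0 (s : seq nat) (P : pred nat) (F : nat -> E) :
  (forall i, P i -> 0 \le F i) -> 0 \le \sum_(i <- s | P i) F i.
Proof. by move=> F0; elim/big_ind: _ => //; [exact: riesz_lexx|exact: raddr_ge0]. Qed.

Lemma rler_sum (s : seq nat) (P : pred nat) (F G : nat -> E) :
  (forall i, P i -> F i \le G i) ->
  \sum_(i <- s | P i) F i \le \sum_(i <- s | P i) G i.
Proof.
move=> FG; rewrite -rsubr_ge0 -sumrB; apply: rsumr_ge0 => i /FG.
by rewrite rsubr_ge0.
Qed.

Lemma rler_wpZ (a b : R) x : 0 \le x -> a <= b -> a *: x \le b *: x.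
Proof.
by move=> x0 ab; rewrite -rsubr_ge0 -scalerBl riesz_scale_ge0 ?subr_ge0.
Qed.

Lemma rmeetDr x y z : (x \wedge y) + z = (x + z) \wedge (y + z).
Proof.
apply: rle_anti; first by rewrite riesz_lexI !rleD2r rleIl rleIr.
by rewrite -rleBlDr riesz_lexI !rleBlDr rleIl rleIr.
Qed.

(** Both [x \wedge y] and [x \vee y] are determined by [x + y] and the other
    one, so lattice morphisms need only be checked on meets. *)
Lemma rjoinE x y : x \vee y = x + y - x \wedge y.
Proof.
apply: rle_anti.
  rewrite riesz_leUx -addrA rler_wpDr ?rsubr_ge0 ?rleIr//.
  by rewrite addrCA rler_wpDr// rsubr_ge0 rleIl.
rewrite rleBlDr [X in _ \le X]addrC -rleBlDr riesz_lexI !rleBlDr.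
by rewrite (rleD (riesz_lexx _) (rleUr _ _)) addrC
  (rleD (riesz_lexx _) (rleUl _ _)).
Qed.

(** The remainders of two vectors over their meet are disjoint: applied to
    [f] and [tau g] this is the source of the disjoint sequence. *)
Lemma rmeetBB x y : (x - x \wedge y) \wedge (y - x \wedge y) = 0.
Proof. by rewrite -rmeetDr subrr. Qed.

Lemma disjoint_mono x y z t : 0 \le x -> x \le y -> 0 \le z -> z \le t ->
  y \wedge t = 0 -> x \wedge z = 0.
Proof.
move=> x0 xy z0 zt yt; apply: rle_anti; last by rewrite riesz_lexI x0.
by rewrite -yt riesz_lexI (rle_trans (rleIl _ _) xy) (rle_trans (rleIr _ _) zt).
Qed.

(** What is left of [(x + y) \wedge z] after removing [y \wedge z] lies below
    both [x] and [z]. *)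
Lemma disjointD x y z : 0 \le x -> 0 \le y -> 0 \le z ->
  x \wedge z = 0 -> y \wedge z = 0 -> (x + y) \wedge z = 0.
Proof.
move=> x0 y0 z0 xz yz.
set t := (x + y) \wedge z.
apply: rle_anti; last by rewrite riesz_lexI raddr_ge0.
have tz : t \le z := rleIr _ _.
rewrite -[X in _ \le X]add0r -{1}xz -yz -rleBlDr riesz_lexI yz subr0 tz andbT.
rewrite -[X in _ \le X]addr0 -yz addrC -rleBlDr riesz_lexI.
rewrite rleBlDr [y + x]addrC rleIl/= rleBlDr.
exact: rle_trans tz (rler_wpDr _ x0).
Qed.

End RieszArithmetic.

(** * Lattice norms *)

Section LatticeNorm.
Context (R : realType) (E : banachLatticeType R).
Implicit Types x y z : E.

Lemma modulus_ge0 x : 0 \le modulus x.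
Proof.
have m2 : 0 \le modulus x + modulus x.
  by rewrite -[0](subrr x); apply: rleD (rleUl _ _) (rleUr _ _).
have -> : modulus x = 2^-1 *: (modulus x + modulus x).
  by rewrite -mulr2n -[modulus x *+ 2]scaler_nat scalerA mulVf ?scale1r.
by apply: riesz_scale_ge0 => //; rewrite invr_ge0.
Qed.

Lemma ger0_modulus x : 0 \le x -> modulus x = x.
Proof.
move=> x0; apply: rle_anti; last exact: rleUl.
rewrite riesz_leUx riesz_lexx/=; apply: (rle_trans _ x0).
by rewrite -[X in _ \le X]oppr0 rleN2.
Qed.

Lemma norm_modulus x : `|modulus x| = `|x|.
Proof.
have e := ger0_modulus (modulus_ge0 x).
by apply/eqP; rewrite eq_le !ler_norm_modulus// e riesz_lexx.
Qed.

Lemma ler_norm_modulusl x y : modulus x \le y -> `|x| <= `|y|.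
Proof.
move=> xy; apply: ler_norm_modulus; rewrite (ger0_modulus (x := y))//.
exact: rle_trans (modulus_ge0 x) xy.
Qed.

Lemma ler_norm_riesz x y : 0 \le x -> x \le y -> `|x| <= `|y|.
Proof. by move=> x0 xy; apply: ler_norm_modulusl; rewrite ger0_modulus. Qed.

(** Shifting both entries of a meet by [modulus (x - y)] shifts the meet, so
    taking meets with [z] is a contraction. *)
Lemma ler_norm_meetB x y z : `|x \wedge z - y \wedge z| <= `|x - y|.
Proof.
rewrite -(norm_modulus (x - y)).
have meet_le (u v m : E) : 0 \le m -> u - v \le m ->
    u \wedge z - v \wedge z \le m.
  move=> m0 uvm; rewrite rleBlDr addrC rmeetDr riesz_lexI.
  rewrite (rle_trans (rleIr _ _) (rler_wpDr _ m0)) andbT.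
  by rewrite addrC -rleBlDr (rle_trans _ uvm)// rleD2r rleIl.
apply: ler_norm_modulusl.
by rewrite riesz_leUx opprB !meet_le ?modulus_ge0 -?[y - x]opprB ?rleUl ?rleUr.
Qed.

Lemma cvg_rmeet T (F : set_system T) (FF : Filter F) (f g : T -> E) x y :
  f t @[t --> F] --> x -> g t @[t --> F] --> y ->
  (f t \wedge g t) @[t --> F] --> x \wedge y.
Proof.
move=> /cvgrPdist_lt fx /cvgrPdist_lt gy; apply/cvgrPdist_lt => e e0.
have e20 : 0 < e / 2 by rewrite divr_gt0.
near=> t; rewrite (splitr e) -(subrKA (f t \wedge y)).
apply: le_lt_trans (ler_normD _ _) _; apply: ltrD.
  by apply: le_lt_trans (ler_norm_meetB _ _ _) _; near: t; exact: fx.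
rewrite ![f t \wedge _]rmeetC.
by apply: le_lt_trans (ler_norm_meetB _ _ _) _; near: t; exact: gy.
Unshelve. all: by end_near. Qed.

(** Both coefficients are dominated by a common [k > 0], and scaling by [k] is an
    order isomorphism. *)
Lemma disjointZ (a b : R) x y : 0 <= a -> 0 <= b ->
  x \wedge y = 0 -> (a *: x) \wedge (b *: y) = 0.
Proof.
move=> a0 b0 xy0.
have x0 : 0 \le x by rewrite -xy0 rleIl.
have y0 : 0 \le y by rewrite -xy0 rleIr.
pose k := a + b + 1; have k0 : 0 < k by rewrite ltr_wpDl ?addr_ge0.
have ak : a <= k by rewrite /k -addrA lerDl addr_ge0.
have bk : b <= k by rewrite /k addrAC lerDr addr_ge0.
have {}xy0 : (k *: x) \wedge (k *: y) = 0.
  apply: rle_anti; last by rewrite riesz_lexI !riesz_scale_ge0 ?ltW.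
  set t := _ \wedge _.
  have kt z : t \le k *: z -> k^-1 *: t \le z.
    move=> tz; rewrite -rsubr_ge0 -[z](scalerK (lt0r_neq0 k0)) -scalerBr.
    by rewrite riesz_scale_ge0 ?invr_ge0 ?ltW// rsubr_ge0.
  have : k^-1 *: t \le 0 by rewrite -xy0 riesz_lexI !kt ?rleIl ?rleIr.
  rewrite -rsubr_ge0 sub0r => /(riesz_scale_ge0 _ _ (ltW k0)).
  by rewrite scalerN scalerKV ?lt0r_neq0// -sub0r rsubr_ge0.
by apply: disjoint_mono xy0; rewrite ?riesz_scale_ge0 ?rler_wpZ.
Qed.

Lemma disjoint_sum (s : seq nat) (P : pred nat) (F : nat -> E) x : 0 \le x ->
  (forall i, P i -> 0 \le F i) -> (forall i, P i -> F i \wedge x = 0) ->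
  (\sum_(i <- s | P i) F i) \wedge x = 0.
Proof.
move=> x0 F0 Fx; elim: s => [|i s IH]; first by rewrite big_nil; exact/rmeet_idPl.
by rewrite big_cons; case: ifP => // Pi; rewrite disjointD ?F0 ?Fx ?rsumr_ge0.
Qed.

End LatticeNorm.

(** * Norm-dominated extension of functionals *)

Section HahnBanach.
Context (R : realType) (E : normedModType R).

(** Functionals defined on a part of [E] are handled through their graphs. A
    graph dominated by the norm is automatically single-valued, and a union of a
    chain of graphs is a graph. *)
Definition dominated_graph (A : set (E * R)) : Prop :=
  [/\ A (0, 0),
      forall (a : R) x r y s, A (x, r) -> A (y, s) ->
        A (a *: x + y, a * r + s) &
      forall x r, A (x, r) -> r <= `|x|].

Lemma dominated_graph_fun A x r s :
  dominated_graph A -> A (x, r) -> A (x, s) -> r = s.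
Proof.
move=> [_ lin dom].
have le a b : A (x, a) -> A (x, b) -> b <= a.
  move=> Aa Ab; have := dom _ _ (lin (-1) _ _ _ _ Aa Ab).
  by rewrite scaleN1r mulN1r addNr normr0 addrC subr_le0.
by move=> Ar As; apply/eqP; rewrite eq_le !le.
Qed.

(** The one-dimensional step: the value [c] at [y] has to satisfy
    [r - `|x - y| <= c <= `|x + y| - r] for all [(x, r)] in the graph, and the
    triangle inequality puts every lower bound below every upper bound. *)
Lemma dominated_graph_extend A y : dominated_graph A ->
  exists2 B, dominated_graph B & A `<=` B /\ exists r, B (y, r).
Proof.
move=> [A0 lin dom].
have scale a x r : A (x, r) -> A (a *: x, a * r).
  by move=> Ax; have := lin a _ _ _ _ Ax A0; rewrite !addr0.
pose L := [set p.2 - `|p.1 - y| | p in A].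
have L_ub x' r' : A (x', r') -> ubound L (`|x' + y| - r').
  move=> Ax' _ [[x r] Ax <-] /=; rewrite lerBlDr addrAC lerBrDr.
  have := dom _ _ (lin 1 _ _ _ _ Ax Ax').
  rewrite scale1r mul1r => /le_trans; apply.
  have -> : x + x' = (x - y) + (x' + y) by rewrite addrACA addNr addr0.
  by rewrite addrC ler_normD.
have L_sup : has_sup L.
  split; first by exists (0 - `|0 - y|), (0, 0).
  by exists (`|0 + y| - 0); exact: L_ub A0.
pose c := sup L.
have c_ge x r : A (x, r) -> r - `|x - y| <= c.
  by move=> Ax; apply: ub_le_sup; [case: L_sup|exists (x, r)].
have c_le x r : A (x, r) -> c <= `|x + y| - r.
  by move=> Ax; apply: ge_sup; [case: L_sup|exact: L_ub].
exists [set p | exists x r t, [/\ A (x, r) & p = (x + t *: y, r + t * c)]].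
  split.
  - by exists 0, 0, 0; split => //; rewrite scale0r mul0r !addr0.
  - move=> a _ _ _ _ [x1 [r1 [t1 [A1 [-> ->]]]]] [x2 [r2 [t2 [A2 [-> ->]]]]].
    exists (a *: x1 + x2), (a * r1 + r2), (a * t1 + t2); split; first exact: lin.
    by rewrite !scalerDr !mulrDr scalerDl mulrDl scalerA mulrA
      [in LHS]addrACA [X in (_, X)]addrACA.
  - move=> _ _ [x [r [t [Ax [-> ->]]]]].
    have [t0|t0|->] := ltgtP t 0; last first.
    + by rewrite scale0r mul0r !addr0; exact: dom.
    + have -> : x + t *: y = t *: (t^-1 *: x + y).
        by rewrite scalerDr scalerA divff ?gt_eqF// scale1r.
      rewrite normrZ gtr0_norm// -ler_pdivrMl// mulrDr mulKf ?gt_eqF//.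
      by rewrite addrC -lerBrDr; apply: c_le; exact: scale.
    + have -> : x + t *: y = - t *: ((- t)^-1 *: x - y).
        by rewrite scalerBr scalerA divff ?oppr_eq0 ?lt_eqF// scale1r scaleNr opprK.
      have nt0 : 0 < - t by rewrite oppr_gt0.
      rewrite normrZ gtr0_norm// -ler_pdivrMl// mulrDr -[t * c]opprK -mulNr mulrN.
      rewrite mulKf ?gt_eqF// lerBlDr addrC -lerBlDr.
      by apply: c_ge; exact: scale.
split; last by exists c, 0, 0, 1; split => //; rewrite scale1r mul1r !add0r.
by move=> [x r] Ax; exists x, r, 0; split => //; rewrite scale0r mul0r !addr0.
Qed.

(** Hahn-Banach: a graph that is maximal among those containing [A] has all of
    [E] as its domain, by the one-dimensional step. *)
Lemma dominated_graph_total A : dominated_graph A ->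
  exists f : dual E, forall x r, A (x, r) -> f x = r.
Proof.
move=> domA.
(* [A `|` B] instead of [A `<=` B], so that the empty chain has an upper bound *)
pose P := [set B : set (E * R) | dominated_graph (A `|` B)].
have [F FP totF|B [PB maxB]] := @Zorn_bigcup _ P.
  have [[B0 FB0]|F0] := pselect (exists B, F B); last first.
    rewrite /P /=; have -> : \bigcup_(X in F) X = set0.
      by apply/seteqP; split => // p [B FB]; case: F0; exists B.
    by rewrite setU0.
  have chain p q : (A `|` \bigcup_(X in F) X) p -> (A `|` \bigcup_(X in F) X) q ->
      exists2 B, F B & (A `|` B) p /\ (A `|` B) q.
    move=> [Ap|[B FB Bp]] [Aq|[C FC Cq]].
    - by exists B0 => //; split; left.
    - by exists C => //; split; [left|right].
    - by exists B => //; split; [right|left].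
    - have [BC|CB] := totF _ _ FB FC.
        by exists C => //; split; right => //; exact: BC.
      by exists B => //; split; right => //; exact: CB.
  split.
  - by left; case: domA.
  - move=> a x r y s px py; have [B FB [Bx By]] := chain _ _ px py.
    have [_ lin _] := FP _ FB.
    by have [?|?] := lin a _ _ _ _ Bx By; [left|right; exists B].
  - move=> x r px; have [B FB [Bx _]] := chain _ _ px px.
    by have [_ _ dom] := FP _ FB; exact: dom.
have total x : exists r, (A `|` B) (x, r).
  have [C domC [ABC [r Cr]]] := dominated_graph_extend x PB.
  exists r; apply: contrapT => ABr; apply: (maxB C).
    split; first by move=> p Bp; apply: ABC; right.
    by move=> /(_ _ Cr) Bx; apply: ABr; right.
  by rewrite /P /= setUidr// => p Ap; apply: ABC; left.
have [f fAB] := choice total.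
have [AB0 lin dom] := PB.
have f_eq x r : (A `|` B) (x, r) -> f x = r.
  by move=> /(dominated_graph_fun PB (fAB x)).
have f_lin : linear (f : E -> R^o).
  by move=> a x y; apply: f_eq; exact: lin.
have f_le x : `|f x| <= `|x|.
  rewrite ler_norml dom// andbT lerNl -normrN.
  apply: dom; have := lin (-1) _ _ _ _ (fAB x) AB0.
  by rewrite scaleN1r mulN1r !addr0.
pose g := HB.pack_for {linear E -> R^o} f
  (GRing.isLinear.Build R E R^o *:%R f f_lin).
have f_cont : continuous (f : E -> R^o).
  apply: (@bounded_linear_continuous _ _ _ g); apply/linear_boundedP.
  near=> r => x; rewrite (le_trans (f_le x))// ler_peMl//.
exists (Dual (mem_set (conj f_lin f_cont))) => x r Ax.
by apply: f_eq; left.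
Unshelve. all: by end_near. Qed.

(** On the span of [G] and [z] the functional [g + t *: z |-> t * d] is dominated
    by the norm, because [z] has distance at least [d] from [G]. *)
Lemma dual_separation (G : set E) (z : E) (d : R) :
  G 0 -> (forall a x y, G x -> G y -> G (a *: x + y)) ->
  0 < d -> (forall g, G g -> d <= `|z - g|) ->
  exists f : dual E, (forall g, G g -> f g = 0) /\ f z != 0.
Proof.
move=> G0 Glin d0 dG.
have [|f fA] := @dominated_graph_total
    [set p | exists g t, [/\ G g & p = (g + t *: z, t * d)]].
  split.
  - by exists 0, 0; split => //; rewrite scale0r mul0r addr0.
  - move=> a _ _ _ _ [g [t [Gg [-> ->]]]] [h [s [Gh [-> ->]]]].
    exists (a *: g + h), (a * t + s); split; first exact: Glin.
    by rewrite scalerDr scalerDl mulrDl scalerA mulrA [in LHS]addrACA.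
  - move=> _ _ [g [t [Gg [-> ->]]]].
    have [->|t0] := eqVneq t 0; first by rewrite mul0r.
    (* [- t^-1 *: g + 0] has the shape of the closure condition on [G] *)
    have -> : g + t *: z = t *: (z - (- t^-1 *: g + 0)).
      by rewrite addr0 scalerBr scalerA mulrN divff// scaleN1r opprK addrC.
    rewrite normrZ (le_trans (ler_norm _))// normrM (gtr0_norm d0).
    by rewrite ler_wpM2l// dG//; exact: Glin.
exists f; split => [g Gg|].
  by apply: fA; exists g, 0; split => //; rewrite scale0r mul0r addr0.
suff -> : f z = d by rewrite gt_eqF.
by apply: fA; exists 0, 1; split => //; rewrite scale1r mul1r add0r.
Qed.

End HahnBanach.

(** * Weak limits *)

Lemma dual_weak_limit (R : realType) (E : normedModType R) (u : nat -> E)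
    (x : E) (f : dual E) (l : R) N :
  weakly_converges u x -> (forall n, (N <= n)%N -> f (u n) = l) -> f x = l.
Proof.
move=> ux ful; apply: (cvg_unique (@Rhausdorff R) (ux f)).
by apply: cvg_near_cst; exists N.
Qed.

(** The pointwise limit of [u] on the dual is a bounded functional, which
    reflexivity represents by a vector. *)
Lemma reflexive_weak_limit (R : realType) (E : normedModType R) (u : nat -> E)
    (K : R) :
  reflexive_space E -> (forall n, `|u n| <= K) -> weakly_cauchy u ->
  exists x, weakly_converges u x.
Proof.
move=> refl uK uC.
have u_cvg (f : dual E) : cvgn (fun n => f (u n)) by apply: cauchy_cvg; exact: uC.
pose L (f : dual E) : R^o := limn (fun n => f (u n)).
have L_lin : linear L.
  move=> a f g; apply: (cvg_lim (@Rhausdorff R)).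
  by apply: cvgD; [apply: cvgZr; exact: u_cvg|exact: u_cvg].
pose L' := HB.pack_for {linear dual E -> R^o} L
  (GRing.isLinear.Build R (dual E) R^o *:%R L L_lin).
have L_cont : continuous L.
  apply: (@bounded_linear_continuous _ _ _ L'); apply/linear_boundedP.
  near=> r => f; have /cvg_norm fu := u_cvg f.
  rewrite -(cvg_lim (@Rhausdorff R) fu); apply: limr_le; first exact/cvgP/fu.
  apply: nearW => n; apply: le_trans (ler_dual_norm f (u n)) _.
  rewrite mulrC ler_wpM2r//; first exact: (normr_ge0 f).
  by apply: le_trans (uK n) _; near: r; apply: nbhs_pinfty_ge; exact: num_real.
have [x _ xL] := refl (Dual (mem_set (conj L_lin L_cont))) I.
exists x => f; have -> : f x = L f.
  by exact: (congr1 (fun h : dual (dual E) => h f) xL).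
exact: u_cvg.
Unshelve. all: by end_near. Qed.

(** * The copy of c0 spanned by a disjoint sequence *)

Fact c0_delta_subproof (R : realType) (k : nat) :
  (fun i => (i == k)%:R : R) \in @null_sequence R.
Proof.
apply/mem_set; apply: cvg_near_cst; exists k.+1 => // n /= kn.
by rewrite gtn_eqF.
Qed.

Definition c0_delta (R : realType) (k : nat) : c0 R :=
  C0 (c0_delta_subproof R k).

Section C0Embedding.
Context (R : realType) (E : banachLatticeType R) (v : nat -> E) (c M : R).
Hypothesis v_ge0 : forall i, 0 \le v i.
Hypothesis v_disjoint : forall i j, i != j -> v i \wedge v j = 0.
Hypothesis c_gt0 : 0 < c.
Hypothesis v_norm : forall i, c <= `|v i|.
Hypothesis v_sum : forall n, `|\sum_(0 <= i < n) v i| <= M.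

Let M_ge0 : 0 <= M.
Proof. exact: le_trans (v_sum 0). Qed.

(** The modulus of such a combination is at most [A] times a partial sum. The
    lower end [m] makes this serve both the Cauchy criterion and boundedness. *)
Lemma norm_comb_le (a : nat -> R) (A : R) m n : 0 <= A ->
  (forall i, (m <= i)%N -> `|a i| <= A) ->
  `|\sum_(m <= i < n) a i *: v i| <= A * M.
Proof.
move=> A0 aA.
apply: (@le_trans _ _ `|A *: \sum_(0 <= i < n) v i|); last first.
  by rewrite normrZ (ger0_norm A0) ler_wpM2l.
apply: ler_norm_modulusl.
have le_v (b : nat -> R) : (forall i, (m <= i)%N -> b i <= A) ->
    \sum_(m <= i < n) b i *: v i \le A *: \sum_(0 <= i < n) v i.
  move=> bA; apply: (@rle_trans _ _ (\sum_(m <= i < n) A *: v i)).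
    rewrite big_nat_cond [X in _ \le X]big_nat_cond; apply: rler_sum => i.
    by rewrite andbT => /andP[mi _]; rewrite rler_wpZ ?bA.
  have Av0 k l : 0 \le \sum_(k <= i < l) A *: v i.
    by apply: rsumr_ge0 => i _; exact: riesz_scale_ge0.
  rewrite scaler_sumr; have [mn|nm] := leqP m n; last by rewrite big_geq// ltnW.
  by rewrite [X in _ \le X](big_cat_nat (n := m))//= rler_wpDl.
rewrite riesz_leUx -sumrN; apply/andP; split.
  by apply: le_v => i /aA; exact/le_trans/ler_norm.
under eq_bigr do rewrite -scaleNr.
by apply: le_v => i /aA; apply: le_trans; rewrite lerNl lerNnormlW.
Qed.

Definition c0_sum (a : c0 R) : E := limn (series (fun i => a i *: v i)).

Lemma cvg_c0_sum (a : c0 R) : series (fun i => a i *: v i) @ \oo --> c0_sum a.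
Proof.
apply/cauchy_cvgP/cauchy_seriesP => e e0.
have M1 : 0 < M + 1 by rewrite ltr_wpDl.
have /set_mem/cvgr0Pnorm_lt /(_ (e / (M + 1))) := c0_funP a.
rewrite divr_gt0// => /(_ isT)[N _ aN].
exists ([set n | (N <= n)%N], setT) => /=; first by split=> //; exists N.
move=> [m n] [/= Nm _].
apply: (@le_lt_trans _ _ (e / (M + 1) * M)).
  apply: norm_comb_le => [|i mi]; first by rewrite divr_ge0 ?ltW.
  by apply/ltW/aN; exact: leq_trans mi.
by rewrite mulrAC ltr_pdivrMr// ltr_pM2l// ltrDl.
Qed.

Lemma c0_sum_lim (a : c0 R) x :
  series (fun i => a i *: v i) @ \oo --> x -> c0_sum a = x.
Proof. exact: (cvg_unique (@norm_hausdorff _ E) (@cvg_c0_sum a)). Qed.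

Fact c0_sum_linear : linear c0_sum.
Proof.
move=> k a b; apply: c0_sum_lim.
have -> : series (fun i => (k *: a + b : c0 R) i *: v i) =
    (fun n => k *: series (fun i => a i *: v i) n + series (fun i => b i *: v i) n).
  apply/funext => n; rewrite /series /= scaler_sumr -big_split /=.
  apply: eq_bigr => i _; rewrite scalerA.
  by transitivity ((k * a i + b i) *: v i); rewrite // scalerDl.
apply: cvgD; last exact: cvg_c0_sum.
by apply: cvgZr; exact: cvg_c0_sum.
Qed.

HB.instance Definition _ :=
  GRing.isLinear.Build R (c0 R) E *:%R c0_sum c0_sum_linear.

(** After subtracting the expected meet from both sides, each index carries a
    nonzero coefficient on at most one side, so the remainders are disjoint. *)
Lemma meet_comb (a b : nat -> R) n :
  series (fun i => a i *: v i) n \wedge series (fun i => b i *: v i) n =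
  series (fun i => Num.min (a i) (b i) *: v i) n.
Proof.
pose m i := Num.min (a i) (b i).
have part (d : nat -> R) : series (fun i => d i *: v i) n =
    \sum_(0 <= i < n) (d i - m i) *: v i + series (fun i => m i *: v i) n.
  rewrite /series /= -big_split/=; apply: eq_bigr => i _.
  by rewrite -scalerDl subrK.
have am i : 0 <= a i - m i by rewrite subr_ge0 ge_min lexx.
have bm i : 0 <= b i - m i by rewrite subr_ge0 ge_min lexx orbT.
rewrite (part a) (part b) -rmeetDr [X in X + _](_ : _ = 0) ?add0r//.
apply: disjoint_sum => [|i _|i _].
    by apply: rsumr_ge0 => i _; exact: riesz_scale_ge0.
  exact: riesz_scale_ge0.
rewrite rmeetC; apply: disjoint_sum => [|j _|j _]; try exact: riesz_scale_ge0.
have [->|ji] := eqVneq j i; last by apply: disjointZ => //; exact: v_disjoint.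
rewrite /m; case: (leP (a i) (b i)) => [ab|/ltW ba]; rewrite subrr scale0r.
  by rewrite rmeetC; apply/rmeet_idPl; rewrite riesz_scale_ge0 ?subr_ge0.
by apply/rmeet_idPl; rewrite riesz_scale_ge0 ?subr_ge0.
Qed.

Lemma c0_sum_meet : {morph c0_sum : a b / a \wedge b}.
Proof.
move=> a b; apply: c0_sum_lim.
rewrite [X in X @ _](_ : _ = (fun n => series (fun i => a i *: v i) n \wedge
    series (fun i => b i *: v i) n)); last first.
  by apply/funext => n; rewrite meet_comb.
by apply: cvg_rmeet; exact: cvg_c0_sum.
Qed.

Lemma c0_sum_join : {morph c0_sum : a b / a \vee b}.
Proof. by move=> a b; rewrite !rjoinE linearB linearD /= c0_sum_meet. Qed.

Lemma c0_sum_delta k : c0_sum (c0_delta R k) = v k.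
Proof.
apply: c0_sum_lim; apply: cvg_near_cst; exists k.+1 => // n /= kn.
rewrite /series /= (bigD1_seq k) ?iota_uniq ?mem_index_iota//= eqxx scale1r.
by rewrite big1 ?addr0// => i /negPf ->; rewrite scale0r.
Qed.

Lemma c0_sum_ge0 (a : c0 R) : 0 \le a -> 0 \le c0_sum a.
Proof.
move=> /rmeet_idPl a0; apply/rmeet_idPl.
by rewrite -[X in X \wedge _ = _](linear0 c0_sum) -c0_sum_meet a0 linear0.
Qed.

Lemma norm_c0_sum_le (a : c0 R) (A : R) :
  (forall i, `|a i| <= A) -> `|c0_sum a| <= A * M.
Proof.
move=> aA; have /cvg_norm sa := @cvg_c0_sum a.
rewrite -(cvg_lim (@norm_hausdorff _ R) sa); apply: limr_le.
  exact/cvgP/sa.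
by apply: nearW => n; apply: norm_comb_le => //; exact: le_trans (aA 0).
Qed.

(** Coordinates are controlled by the norm: the image of [modulus a] is the
    modulus of the image, and [modulus a] dominates [`|a k|] times the [k]-th
    unit vector. *)
Lemma norm_c0_sum_ge (a : c0 R) k : `|a k| * c <= `|c0_sum a|.
Proof.
apply: (@le_trans _ _ `| `|a k| *: v k|).
  by rewrite normrZ normr_id ler_wpM2l.
rewrite -(norm_modulus (c0_sum a)).
apply: ler_norm_riesz; first exact: riesz_scale_ge0.
rewrite /modulus -linearN -c0_sum_join -c0_sum_delta -linearZ -rsubr_ge0 -linearB.
apply: c0_sum_ge0; apply/asboolP => i.
rewrite [leRHS](_ : _ = Num.max (a i) (- a i) - `|a k| * (i == k)%:R)//.
have -> : Num.max (a i) (- a i) = `|a i| by rewrite maxrN.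
have [->|_] := eqVneq i k; first by rewrite mulr1 subrr; exact: lexx.
by rewrite mulr0 subr0; exact: normr_ge0.
Qed.

Lemma c0_sum_inj : injective c0_sum.
Proof.
move=> a b ab; apply/val_inj/funext => k.
have := norm_c0_sum_ge (a - b) k.
rewrite linearB /= ab subrr normr0 pmulr_lle0// normr_le0.
by move=> /eqP/(@subr0_eq R).
Qed.

(** Completeness of [c0], carried out on preimages: if the images of the [a n]
    approach [y], then the [a n] are uniformly Cauchy by [norm_c0_sum_ge], and
    their pointwise limit [b] is a null sequence mapped to [y]. *)
Lemma closed_range_c0_sum : closed (range c0_sum).
Proof.
move=> y yF; pose h n : R := n.+1%:R^-1.
have h_gt0 n : 0 < h n by rewrite invr_gt0.
have /choice[a aP] n : exists a : c0 R, `|y - c0_sum a| < h n.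
  have [_ [[a _ <-]]] := yF _ (nbhsx_ballx y (h n) (h_gt0 n)).
  by rewrite -ball_normE; exists a.
(* twice [h n], as [`|y - c0_sum (a m)|] is also below [h n] for [m >= n] *)
pose D n := 2 / c * h n.
have D0 : D @ \oo --> 0.
  by rewrite -(mulr0 (2 / c)); apply: cvgM; [exact: cvg_cst|exact: cvg_harmonic].
have aD m n k : (n <= m)%N -> `|a n k - a m k| <= D n.
  move=> nm; rewrite /D mulrAC ler_pdivlMr//.
  apply: le_trans (norm_c0_sum_ge (a n - a m) k) _.
  rewrite linearB /= -(subrKA y) (le_trans (ler_normD _ _))// mulr_natl mulr2n.
  rewrite distrC lerD ?ltW// (lt_le_trans (aP m))// lef_pV2 ?posrE//.
  by rewrite ler_nat.
have a_cvg k : cvgn (fun n => a n k).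
  apply/cauchy_cvgP/cauchy_exP => e e0.
  have /cvgr0Pnorm_lt /(_ e e0) [n _ nD] := D0.
  exists (a n k), n => // m /= nm; rewrite -ball_normE /=.
  by apply: le_lt_trans (aD _ _ _ nm) (le_lt_trans (ler_norm _) (nD _ _)) => /=.
pose b k := limn (fun n => a n k).
have bD n k : `|a n k - b k| <= D n.
  have abk : `|a n k - a m k| @[m --> \oo] --> `|a n k - b k|.
    by apply: cvg_norm; apply: cvgB; [exact: cvg_cst|exact: a_cvg].
  rewrite -(cvg_lim (@Rhausdorff R) abk); apply: limr_le; first exact/cvgP/abk.
  by exists n => // m; exact: aD.
have b0 : b \in @null_sequence R.
  apply/mem_set/cvgr0Pnorm_lt => e e0.
  have e20 : 0 < e / 2 by rewrite divr_gt0.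
  have /cvgr0Pnorm_lt /(_ _ e20) [n _ nD] := D0.
  have /set_mem/cvgr0Pnorm_lt /(_ _ e20) := c0_funP (a n).
  apply: filterS => k ank; rewrite (splitr e) -[b k](subKr (a n k)).
  rewrite (le_lt_trans (ler_normB _ _))// ltrD// (le_lt_trans (bD n k))//.
  exact: le_lt_trans (ler_norm _) (nD n (leqnn n)).
exists (C0 b0) => //; apply/esym/eqP; rewrite -subr_eq0 -normr_le0.
have dist_le n : `|y - c0_sum (C0 b0)| <= D n * M + h n.
  rewrite -(subrKA (c0_sum (a n))) addrC (le_trans (ler_normD _ _))//.
  apply: lerD; last exact/ltW/aP.
  by rewrite -(linearB c0_sum) /=; apply: norm_c0_sum_le => k; exact: bD.
have lim0 : (D n * M + h n) @[n --> \oo] --> (0 * M + 0 : R).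
  by apply: cvgD; [apply: cvgMl|exact: cvg_harmonic].
have : `|y - c0_sum (C0 b0)| <= limn (fun n => D n * M + h n).
  by apply: limr_ge; [exact/cvgP/lim0|exact: nearW].
by rewrite (cvg_lim (@Rhausdorff R) lim0) mul0r addr0.
Qed.

(** Choosing signs turns the sum into the value of [f] at one combination with
    coefficients of absolute value at most 1. *)
Lemma sum_norm_dual_le (f : dual E) n :
  \sum_(0 <= i < n) `|f (v i)| <= dual_norm f * M.
Proof.
pose s i : R := Num.sg (f (v i)).
have -> : \sum_(0 <= i < n) `|f (v i)| = f (\sum_(0 <= i < n) s i *: v i).
  rewrite linear_sum; apply: eq_bigr => i _.
  by rewrite linearZ /= normrEsg.
apply: le_trans (ler_norm _) _; apply: le_trans (ler_dual_norm _ _) _.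
apply: ler_wpM2l; first exact: (normr_ge0 f).
rewrite -[M]mul1r; apply: norm_comb_le => // i _.
by rewrite /s normr_sg; case: (_ == _).
Qed.

Lemma weakly_cauchy_partial_sums :
  weakly_cauchy (fun n => \sum_(0 <= i < n) v i).
Proof.
move=> f; apply: cvg_cauchy.
have -> : (fun n => f (\sum_(0 <= i < n) v i)) = series (fun i => f (v i)).
  by apply/funext => n; rewrite linear_sum.
apply: (@normed_cvg R R^o); apply: nondecreasing_is_cvgn.
  by apply: nondecreasing_series => i _ _; exact: normr_ge0.
by exists (dual_norm f * M) => _ [n _ <-]; exact: sum_norm_dual_le.
Qed.

(** A weak limit [x] lies in the closed range of [c0_sum], since otherwise some
    functional vanishing there does not vanish at [x]. If [x] is the image of
    [a], pick [k] with [`|a k| < 1]: then [x - v k] has positive distance from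
    the image of [[set b | b k = 0]]. A functional separating the two takes the
    value [f (v k)] on all partial sums past [k], so [f (x - v k) = 0], which is
    absurd. *)
Lemma partial_sums_no_weak_limit x :
  ~ weakly_converges (fun n => \sum_(0 <= i < n) v i) x.
Proof.
move=> ux.
have range0 : range c0_sum 0 by exists 0 => //; exact: (linear0 c0_sum).
have range_lin k y z : range c0_sum y -> range c0_sum z ->
    range c0_sum (k *: y + z).
  by move=> [a _ <-] [b _ <-]; exists (k *: a + b) => //; exact: c0_sum_linear.
have [[a _ ax]|xF] := pselect (range c0_sum x); last first.
  have /nbhs_ballP[d /= d0 dF] : nbhs x (~` range c0_sum).
    by apply: open_nbhs_nbhs; split => //; exact/closed_openC/closed_range_c0_sum.
  have dist y : range c0_sum y -> d <= `|x - y|.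
    move=> yF; rewrite leNgt; apply/negP => xy; apply: (dF y) => //.
    by rewrite -ball_normE.
  have [f [fF /eqP[]]] := dual_separation range0 range_lin d0 dist.
  apply: (@dual_weak_limit _ _ _ _ _ _ 0 ux) => n _.
  rewrite linear_sum big1// => i _; apply: fF.
  by exists (c0_delta R i) => //; exact: c0_sum_delta.
have [k ak] : exists k, `|a k| < 1.
  have /set_mem/cvgr0Pnorm_lt /(_ 1 ltr01) [k _ ak] := c0_funP a.
  by exists k; apply: ak => /=.
pose G := [set c0_sum b | b in [set b : c0 R | b k = 0]].
have G0 : G 0 by exists 0 => //; exact: (linear0 c0_sum).
have G_lin l y z : G y -> G z -> G (l *: y + z).
  move=> [b bk <-] [b' bk' <-]; exists (l *: b + b'); last exact: c0_sum_linear.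
  by transitivity (l * b k + b' k) => //; rewrite bk bk' mulr0 addr0.
have d0 : 0 < `|a k - 1| * c.
  rewrite mulr_gt0// normr_gt0 subr_eq0; apply: contraTneq ak => ->.
  by rewrite normr1 ltxx.
have dist y : G y -> `|a k - 1| * c <= `|x - v k - y|.
  move=> [b bk <-]; rewrite -ax -c0_sum_delta -!(linearB c0_sum) /=.
  apply: le_trans (norm_c0_sum_ge _ k).
  rewrite [X in _ <= `|X| * _](_ : _ = a k - (k == k)%:R - b k)//.
  by rewrite eqxx bk subr0.
have [f [fG /eqP[]]] := dual_separation G0 G_lin d0 dist.
rewrite linearB /= (@dual_weak_limit _ _ _ _ _ (f (v k)) k.+1 ux) ?subrr// => n kn.
rewrite linear_sum (bigD1_seq k) ?iota_uniq ?mem_index_iota//= big1 ?addr0// => i ik.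
apply: fG; exists (c0_delta R i); last exact: c0_sum_delta.
by rewrite /= eq_sym (negPf ik).
Qed.

Lemma not_AL_space_disjoint_bounded : ~ AL_space E.
Proof.
move=> AL.
have norm_sum n : n%:R * c <= `|\sum_(0 <= i < n) v i|.
  elim: n => [|n IH]; first by rewrite mul0r.
  rewrite big_nat_recr//= AL; first by rewrite -natr1 mulrDl mul1r lerD.
  rewrite big_nat_cond; apply: disjoint_sum => // i.
  by rewrite andbT => /andP[_ i_n]; rewrite v_disjoint// ltn_eqF.
have Mc0 : 0 <= M / c by rewrite divr_ge0 ?(ltW c_gt0).
have := archi_boundP Mc0; rewrite ltr_pdivrMr//.
move=> /(le_lt_trans (v_sum (Num.bound (M / c)))).
by move=> /(le_lt_trans (norm_sum _)); rewrite ltxx.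
Qed.

Lemma c0_sublattice : exists F : set E,
  [/\ riesz_subspace F, closed F & lattice_isomorphic (c0 R) F].
Proof.
exists (range c0_sum); split; last 1 first.
- exists (c0_sum : {linear c0 R -> E}); split.
  + split; [by move=> a _; exists a|by move=> a b _ _; exact: c0_sum_inj|].
    by move=> y [a _ <-]; exists a.
  + exact: c0_sum_meet.
  + exact: c0_sum_join.
- split; first by exists 0 => //; exact: (linear0 c0_sum).
  + by move=> k _ _ [a _ <-] [b _ <-]; exists (k *: a + b) => //; exact: c0_sum_linear.
  + by move=> _ _ [a _ <-] [b _ <-]; exists (a \wedge b) => //; exact: c0_sum_meet.
  + by move=> _ _ [a _ <-] [b _ <-]; exists (a \vee b) => //; exact: c0_sum_join.
- exact: closed_range_c0_sum.
Qed.

End C0Embedding.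

(** * Truncations *)

Section Truncation.
Context (R : realType) (E : banachLatticeType R) (tau : E -> E).
Hypothesis tau_trunc : truncation tau.

Lemma trunc_ge0 f : 0 \le f -> 0 \le tau f.
Proof. exact: tau_trunc.1. Qed.

Lemma trunc_le f : 0 \le f -> tau f \le f.
Proof.
by move=> f0; rewrite -[tau f]rmeetxx tau_trunc.2 ?trunc_ge0// rleIl.
Qed.

Lemma trunc_meet f g : 0 \le f -> f \le g -> tau f = f \wedge tau g.
Proof.
move=> f0 fg; rewrite -tau_trunc.2 //; last exact: rle_trans f0 fg.
by apply/esym/rmeet_idPl; exact: rle_trans (trunc_le f0) fg.
Qed.

Lemma trunc_mono f g : 0 \le f -> f \le g -> tau f \le tau g.
Proof. by move=> f0 fg; rewrite (trunc_meet f0 fg) rleIr. Qed.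

(** In terms of a unit: [f - tau f] lives where [f > 1], and there both [tau f]
    and [tau g] are already 1. *)
Lemma trunc_disjoint f g : 0 \le f -> f \le g ->
  (f - tau f) \wedge (tau g - tau f) = 0.
Proof. by move=> f0 fg; rewrite (trunc_meet f0 fg) rmeetBB. Qed.

(** The limit of the net of all [tau f] is a unit: pass to the limit over [g] in
    [tau f = f \wedge tau g]. The net is encoded as the filter generated by the
    images of the upper sections of the cone. *)
Lemma trunc_cauchy_unital :
  (forall e : R, 0 < e -> exists2 f, 0 \le f &
     forall g, f \le g -> `|tau f - tau g| < e) -> unital_truncation tau.
Proof.
move=> tauC.
pose F := filter_from [set f : E | 0 \le f] (fun f => tau @` [set g | f \le g]).
have FF : ProperFilter F.
  apply: filter_from_proper => [|f _]; last first.
    by exists (tau f), f => //=; exact: riesz_lexx.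
  apply: filter_from_filter; first by exists 0; exact: riesz_lexx.
  move=> f g f0 g0; exists (f \vee g) => /=; first exact: rle_trans f0 (rleUl _ _).
  by move=> _ [h /= + <-]; rewrite riesz_leUx => /andP[fh gh]; split; exists h.
have /cauchy_cvg Fu : cauchy F.
  apply/cauchy_exP => e /tauC[f f0 fe]; exists (tau f), f => //.
  by move=> _ [g /= fg <-]; rewrite -ball_normE; exact: fe.
have trunc_lim f : 0 \le f -> tau f = lim F \wedge f.
  move=> f0; have cst_f : (g \wedge f) @[g --> F] --> tau f.
    apply: cvg_near_cst; exists f => // _ [g /= fg <-].
    by rewrite rmeetC -trunc_meet.
  exact: (cvg_unique (@norm_hausdorff _ E) cst_f (cvg_rmeet _ Fu (cvg_cst f))).
exists (lim F) => //.
have := trunc_lim _ (riesz_lexx 0).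
have -> : tau 0 = 0.
  by apply: rle_anti; rewrite ?trunc_le ?trunc_ge0 ?riesz_lexx.
by move=> u0; rewrite {1}u0 rleIl.
Qed.

Hypothesis tau_bounded : bounded_truncation tau.

Lemma bounded_trunc_norm :
  exists2 M : R, 0 <= M & forall f, 0 \le f -> `|tau f| <= M.
Proof.
have sup_ge f : 0 \le f ->
    ((`|tau f|)%:E <= ereal_sup [set (`|tau f|)%:E | f in pos_cone E])%E.
  by move=> f0; apply: ereal_sup_ubound; exists f.
have := tau_bounded; rewrite /bounded_truncation.
move: sup_ge; case: ereal_sup => [M|_ //|].
  move=> sup_ge _; exists M => [|f /sup_ge]; last by rewrite lee_fin.
  by have := sup_ge _ (riesz_lexx 0); rewrite lee_fin; exact: le_trans.
by move=> /(_ _ (riesz_lexx 0)); rewrite leeNy_eq.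
Qed.

Hypothesis tau_not_unital : ~ unital_truncation tau.

Lemma trunc_gap : exists2 e : R, 0 < e &
  forall f, 0 \le f -> exists2 g, f \le g & e <= `|tau g - tau f|.
Proof.
apply: contrapT => gap; apply/tau_not_unital/trunc_cauchy_unital => e e0.
apply: contrapT => noC; apply: gap; exists e => // f f0.
apply: contrapT => nog; apply: noC; exists f => // g fg.
by rewrite ltNge; apply/negP => eg; apply: nog; exists g; rewrite 1?distrC.
Qed.

(** From [a n], a jump leads to [b n], and [a n.+1 = k *: b n]. The piece [v n] is
    the jump [tau (b n) - tau (a n)] cut off at the height [k^-1] of the unit,
    with [tau (a n.+1)] in place of the unit. Two bounds on it give
    disjointness: [v n] is below [a n.+1 - tau (a n.+1)], and every later piece is
    below [tau b - tau (a n.+1)] for some [b] above [a n.+1]. *)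
Lemma trunc_disjoint_sequence : exists (v : nat -> E) (c M : R),
  [/\ forall i, 0 \le v i, forall i j : nat, i != j -> v i \wedge v j = 0,
      0 < c, forall i, c <= `|v i| &
      forall n, `|\sum_(0 <= i < n) v i| <= M].
Proof.
have [M M0 tauM] := bounded_trunc_norm.
have [e e0 gap] := trunc_gap.
have /choice[h hP] f : exists g, 0 \le f -> f \le g /\ e <= `|tau g - tau f|.
  have [/gap[g fg eg]|?] := pselect (0 \le f); first by exists g.
  by exists 0.
(* the cut costs at most [M / k] in norm, which must stay below [e] *)
pose k := M / e + 1.
have k0 : 0 < k by rewrite ltr_wpDl ?divr_ge0 ?(ltW e0).
have k1 : k^-1 <= 1 by rewrite invf_le1// lerDr divr_ge0 ?(ltW e0).
pose a n := iter n (fun f => k *: h f) 0.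
have a0 n : 0 \le a n.
  elim: n => [|n IH]; first exact: riesz_lexx.
  by apply: riesz_scale_ge0; [exact: ltW|exact: rle_trans IH (hP _ IH).1].
pose b n := h (a n).
have ab n : a n \le b n := (hP _ (a0 n)).1.
have b0 n : 0 \le b n := rle_trans (a0 n) (ab n).
have ba n : b n = k^-1 *: a n.+1 by rewrite /= scalerK ?lt0r_neq0.
have ba_le n : b n \le a n.+1.
  by rewrite ba -[X in _ \le X]scale1r rler_wpZ.
have a_mono m n : (m <= n)%N -> a m \le a n.
  move=> /subnK <-; elim: (n - m)%N => [|p IH]; first exact: riesz_lexx.
  by apply: rle_trans IH _; apply: rle_trans (ab _) (ba_le _).
have tau_le x y : 0 \le x -> x \le y -> 0 \le tau y - tau x.
  by move=> x0 xy; rewrite rsubr_ge0 trunc_mono.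
pose w n := tau (b n) - tau (a n).
pose v n := (w n - k^-1 *: tau (a n.+1)) \vee 0.
have kt0 n : 0 \le k^-1 *: tau (a n).
  by rewrite riesz_scale_ge0 ?trunc_ge0// invr_ge0 ltW.
have v0 n : 0 \le v n := rleUr _ _.
have vw n : v n \le w n.
  by rewrite riesz_leUx tau_le// andbT rleBlDr rler_wpDr.
have va n : v n \le a n.+1 - tau (a n.+1).
  have r0 : 0 \le a n.+1 - tau (a n.+1) by rewrite rsubr_ge0 trunc_le.
  rewrite riesz_leUx r0 andbT -[X in _ \le X]scale1r.
  apply: rle_trans (rler_wpZ r0 k1); rewrite scalerBr rleD2r -ba.
  apply: rle_trans (trunc_le (b0 n)).
  by rewrite rleBlDr rler_wpDr ?trunc_ge0.
have v_lt m n : (m < n)%N -> v m \wedge v n = 0.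
  move=> mn; have amb : a m.+1 \le b n := rle_trans (a_mono _ _ mn) (ab n).
  apply: disjoint_mono (trunc_disjoint (a0 m.+1) amb) => //.
  apply: rle_trans (vw n) _.
  by rewrite rleD ?riesz_lexx// rleN2 trunc_mono// a_mono.
exists v, (e - k^-1 * M), M; split => //.
- move=> i j; rewrite neq_ltn => /orP[/v_lt//|/v_lt].
  by rewrite rmeetC.
- rewrite subr_gt0 mulrC ltr_pdivrMr// mulrDr mulr1 mulrCA divff ?lt0r_neq0//.
  by rewrite mulr1 ltrDl.
- move=> i; rewrite lerBlDr.
  apply: le_trans (hP _ (a0 i)).2 _; rewrite -/(b i) -/(w i).
  apply: (@le_trans _ _ `|v i + k^-1 *: tau (a i.+1)|).
    apply: ler_norm_riesz; first exact: tau_le.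
    by rewrite -rleBlDr rleUl.
  apply: le_trans (ler_normD _ _) _; rewrite lerD2l normrZ gtr0_norm ?invr_gt0//.
  by rewrite ler_wpM2l ?invr_ge0 ?(ltW k0)// tauM.
- move=> n; apply: le_trans (tauM _ (a0 n)).
  apply: ler_norm_riesz; first exact: rsumr_ge0.
  elim: n => [|n IH]; first by rewrite big_geq// trunc_ge0.
  rewrite big_nat_recr//=; apply: rle_trans (trunc_mono (b0 n) (ba_le n)).
  by apply: rle_trans (rleD IH (vw n)) _; rewrite addrC subrK riesz_lexx.
Qed.

End Truncation.

Unset Implicit Arguments.

Theorem theorem3p5 (R : realType) (E : banachLatticeType R)
    (tau : E -> E) (tau_trunc : truncation tau)
    (tau_bounded : bounded_truncation tau)
    (tau_not_unital : ~ unital_truncation tau) :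
  (exists F : set E,
     [/\ riesz_subspace F, closed F & lattice_isomorphic (c0 R) F]) /\
  ~ reflexive_space E /\
  ~ weakly_sequentially_complete E /\
  ~ AL_space E.
Proof.
have [v [c [M [v0 vv c0 vc vM]]]] :=
  trunc_disjoint_sequence tau_trunc tau_bounded tau_not_unital.
have no_limit := partial_sums_no_weak_limit v0 vv c0 vc vM.
have wcauchy := weakly_cauchy_partial_sums v0 vM.
split; first exact: c0_sublattice v0 vv c0 vc vM.
split.
  by move=> refl; have [x /no_limit] := reflexive_weak_limit refl vM wcauchy.
split; first by move=> wsc; have [x /no_limit] := wsc _ wcauchy.
exact: not_AL_space_disjoint_bounded v0 vv c0 vc vM.
Qed.
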